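(* Let $a_1 < a_2 < a_3$ be positive integers. Then $$\mathbb{P}(a_1,a_2,a_3) \geq \frac{1}{9},$$ with equality if and only if $\{a_1,a_2,a_3\} = \gcd(a_1,a_2,a_3)\cdot\{1,3,9\}$, that is, if and only if $\{a_1,a_2,a_3\}=\{g,3g,9g\}$ with $g=\gcd(a_1,a_2,a_3)$.
   Context: Here $\mathbb{N}$ denotes the positive integers. For $a_1,\dots,a_n\in\mathbb{N}$ define $$\mathbb{P}(a_1,\dots,a_n)=\frac{1}{2\pi}\left|\left\{x\in[0,2\pi]:\ \min_{1\le i\le n}\cos(a_i x)>0\ \text{ or }\ \max_{1\le i\le n}\cos(a_i x)<0\right\}\right|,$$ where $|\cdot|$ denotes Lebesgue measure. Thus $\mathbb{P}(a_1,\dots,a_n)$ is the probability that $\cos(a_1x),\dots,\cos(a_nx)$ are all positive or all negative for $x$ uniform on $[0,2\pi]$. *)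

(* Defs.v *)
From HB Require Import structures.
From mathcomp Require Import all_boot all_order all_algebra.
From mathcomp Require Import all_classical all_reals all_analysis.

Set Implicit Arguments.
Unset Strict Implicit.
Unset Printing Implicit Defensive.

Import Order.TTheory GRing.Theory Num.Theory.
Local Open Scope classical_set_scope.
Local Open Scope ring_scope.

(* The default element [cos (a_0 x)] of both bigops is one of the terms, so
   they are the min and max of the nonempty family. *)
Definition cos_same_sign (R : realType) (n : nat) (a : n.+1.-tuple nat) : set R :=
  [set x | x \in `[0, 2 * pi]
    /\ (0 < \big[Num.min/cos ((tnth a ord0)%:R * x)]_(i < n.+1)
              cos ((tnth a i)%:R * x)
     \/ \big[Num.max/cos ((tnth a ord0)%:R * x)]_(i < n.+1)
              cos ((tnth a i)%:R * x) < 0)].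

Arguments cos_same_sign R {n} a.

(* [fine] loses nothing: the set lies in [0, 2 pi], so its measure is finite. *)
Definition prob_same_sign (R : realType) (n : nat) (a : n.+1.-tuple nat) : R :=
  (2 * pi)^-1 * fine (lebesgue_measure (cos_same_sign R a)).
Arguments prob_same_sign R {n} a.

(* Main.v *)
Require Import Defs.
From HB Require Import structures.
From mathcomp Require Import all_boot all_order all_algebra.
From mathcomp Require Import all_classical all_reals all_analysis.
From mathcomp Require Import measurable_realfun zify ring lra.

Set Implicit Arguments.
Unset Strict Implicit.
Unset Printing Implicit Defensive.

Import Order.TTheory GRing.Theory Num.Theory.
Import numFieldNormedType.Exports.
Local Open Scope classical_set_scope.
Local Open Scope ring_scope.

(** Let [s] be the sign of the cosine.  Three signs agree with indicator
    [(1 + s1 s2 + s1 s3 + s2 s3) / 4], so the probability is determined by the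
    pairwise means [E(a, b)] of [s(a x) s(b x)].  With [a = g x], [b = g y] and
    [x], [y] coprime, [E(a, b)] is [chi(x) chi(y) / (x y)] for [x], [y] odd, where
    [chi] is the nontrivial character modulo 4, and [0] otherwise.  Hence [E(a, b)]
    is either [-1/3], exactly when [b = 3 a], or at least [-1/7]; since the three
    means cannot all be negative, their sum is at least [-10/21 > -5/9] unless two
    of the ratios are [3], and then the sum is [-1/3 - 1/3 + 1/9 = -5/9].

    The means are computed on the grid of [4 a b c] equal cells of [[0, 2 pi]], on
    the interior of which all the cosines have constant sign.  For two coprime
    frequencies [a] and [b], where [4 a b] cells suffice, translation by [4 b j]
    cells, [j < a], fixes one sign and makes the other run through equally spaced
    points. *)

(* The sign of the cosine on the open interval from [p pi / 2] to [(p + 1) pi / 2]. *)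
Definition quadrant_sign (R : pzRingType) (p : nat) : R := (-1) ^+ uphalf p.
Arguments quadrant_sign R p : clear implicits.

(* Agrees with the character modulo 4 only on odd [n]. *)
Definition chi4 (R : pzRingType) (n : nat) : R := (-1) ^+ n./2.
Arguments chi4 R n : clear implicits.

(** * Periodicity of the quadrant sign *)

Lemma quadrant_signD2 (R : pzRingType) (p : nat) :
  quadrant_sign R (p + 2) = - quadrant_sign R p.
Proof. by rewrite /quadrant_sign addn2 /= exprS mulN1r. Qed.

Lemma quadrant_signD4 (R : pzRingType) (p n : nat) :
  quadrant_sign R (p + 4 * n) = quadrant_sign R p.
Proof.
elim: n => [|n IHn]; first by rewrite muln0 addn0.
rewrite -[RHS]IHn (_ : p + 4 * n.+1 = p + 4 * n + 2 + 2)%N; last by lia.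
by rewrite !quadrant_signD2 opprK.
Qed.

Lemma quadrant_sign_mod4 (R : pzRingType) (p : nat) :
  quadrant_sign R (p %% 4) = quadrant_sign R p.
Proof. by rewrite {2}(divn_eq p 4) addnC mulnC quadrant_signD4. Qed.

Lemma quadrant_sign_sq (R : pzRingType) (p : nat) :
  quadrant_sign R p * quadrant_sign R p = 1.
Proof. by rewrite -expr2 sqrr_sign. Qed.

(** On a grid with [u] cells per quadrant, a shift by [4 u n] cells is [n] full turns. *)
Lemma quadrant_sign_divD (R : pzRingType) (k u n : nat) : (0 < u)%N ->
  quadrant_sign R ((k + 4 * u * n) %/ u) = quadrant_sign R (k %/ u).
Proof.
move=> u0; rewrite (_ : 4 * u * n = 4 * n * u)%N; last by lia.
by rewrite addnC divnMDl // addnC quadrant_signD4.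
Qed.

(** * Sums of signs over equally spaced points *)

Lemma sum_nat_mul (V : nmodType) (m n : nat) (f : nat -> V) :
  \sum_(0 <= k < m * n) f k = \sum_(0 <= j < m) \sum_(0 <= l < n) f (j * n + l)%N.
Proof.
elim: m => [|m IHm]; first by rewrite mul0n !big_nil.
rewrite (big_cat_nat (n := m * n)) ?leq_mul2r ?leqnSn ?orbT //= IHm big_nat_recr //=.
congr (_ + _); rewrite -{1}[(m * n)%N]add0n big_addn mulSn addnK.
by apply: eq_bigr => i _; rewrite addnC.
Qed.

(** As [b] is a unit modulo [a], the affine map permutes the residues. *)
Lemma sum_nat_mod_affine (V : nmodType) (a b c : nat) (h : nat -> V) :
  coprime a b ->
  \sum_(0 <= j < a) h ((c + b * j) %% a)%N = \sum_(0 <= j < a) h j.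
Proof.
case: a => [|a] cop; first by rewrite !big_nil.
rewrite !big_mkord.
pose s (j : 'I_a.+1) : 'I_a.+1 := inord ((c + b * j) %% a.+1).
have sE j : s j = ((c + b * j) %% a.+1)%N :> nat by rewrite inordK // ltn_mod.
have s_inj : injective s.
  suff le_inj (i j : 'I_a.+1) : (i <= j)%N -> s i = s j -> i = j.
    move=> i j eij; case: (leqP i j) => [/le_inj|/ltnW/le_inj]; first exact.
    by move=> ->.
  move=> leij /(congr1 val); rewrite /= !sE => /eqP; rewrite eq_sym eqn_modDl.
  rewrite eqn_mod_dvd ?leq_mul2l ?leij ?orbT // -mulnBr Gauss_dvdr // => dvd_ij.
  apply/val_inj => /=; have := ltn_ord j.
  case: (posnP (j - i)) dvd_ij => [|ji0 /(dvdn_leq ji0)]; lia.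
by rewrite [RHS](reindex_inj s_inj); apply: eq_bigr => j _; rewrite sE.
Qed.

(** Of the quadrants 0 to 3 the sign is negative exactly on 1 and 2; the indices [m1] and [m3] are
    where the points enter quadrant 1 and quadrant 3. *)
Lemma sum_quadrant_sign_thresholds (R : pzRingType) (a r m1 m3 : nat) :
  (0 < a)%N -> (m1 <= m3 <= a)%N -> (r < 4)%N ->
  (forall i, (i < m1)%N -> (r + 4 * i < a)%N) ->
  (forall i, (m1 <= i < m3)%N -> (a <= r + 4 * i < 3 * a)%N) ->
  (forall i, (m3 <= i)%N -> (3 * a <= r + 4 * i)%N) ->
  \sum_(0 <= i < a) quadrant_sign R ((r + 4 * i) %/ a) =
    m1%:R - (m3 - m1)%:R + (a - m3)%:R.
Proof.
move=> a0 /andP[le13 le3a] r4 H1 H2 H3.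
rewrite (big_cat_nat (n := m3)) //= (big_cat_nat (n := m1)) //=.
congr (_ + _ + _).
- rewrite (eq_big_nat _ _ (F2 := fun=> 1)); last first.
    by move=> i /andP[_ /H1 lt]; rewrite divn_small.
  by rewrite sumr_const_nat subn0.
- rewrite (eq_big_nat _ _ (F2 := fun=> -1)); last first.
    move=> i /H2/andP[ge lt]; have : ((r + 4 * i) %/ a == 1 \/ (r + 4 * i) %/ a == 2)%N.
      have := leq_divRL 1 (r + 4 * i) a0; have := ltn_divLR (r + 4 * i) 3 a0.
      by move: (_ %/ _)%N => Q; lia.
    by case=> /eqP ->; rewrite /quadrant_sign /= expr1.
  by rewrite sumr_const_nat mulNrn.
- rewrite (eq_big_nat _ _ (F2 := fun=> 1)); last first.
    move=> i /andP[/H3 ge lt]; rewrite (_ : (r + 4 * i) %/ a = 3)%N;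
      first by rewrite /quadrant_sign sqrrN expr1n.
    by have := leq_divRL 3 (r + 4 * i) a0; have := ltn_divLR (r + 4 * i) 4 a0;
      move: (_ %/ _)%N => Q; lia.
  by rewrite sumr_const_nat.
Qed.

(** The sum is [a + 2 m1 - 2 m3], in which the multiples of [m] cancel; what remains depends only on
    [r] and on [a] modulo 4. *)
Lemma sum_quadrant_sign (R : comPzRingType) (a r : nat) : odd a -> (r < 4)%N ->
  \sum_(0 <= i < a) quadrant_sign R ((r + 4 * i) %/ a) =
    chi4 R a * quadrant_sign R r.
Proof.
move=> odda r4.
pose e := odd a./2; pose m := a./2./2.
have aE : a = (4 * m + 1 + 2 * e)%N by rewrite /m /e; lia.
have -> : chi4 R a = (-1) ^+ e by rewrite /chi4 signr_odd.
(* [m1] and [m3] count the [i] with [r + 4 i < a] and with [r + 4 i < 3 a]; [e] tells whether [a] is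
   3 modulo 4. *)
pose m1 := (m + if e then (r < 3)%N else (r < 1)%N)%N.
pose m3 := (3 * m + if e then 2 + (r < 1)%N else (r < 3)%N)%N.
have [m1_le m3_le] : (m1 <= m3)%N /\ (m3 <= a)%N by rewrite /m1 /m3 aE; case: (e); lia.
rewrite (@sum_quadrant_sign_thresholds R a r m1 m3) ?m1_le ?m3_le ?odd_gt0 //; last first.
- by rewrite /m3 aE => i; case: (e); lia.
- by rewrite /m1 /m3 aE => i; case: (e); lia.
- by rewrite /m1 aE => i; case: (e); lia.
rewrite !natrB // /m1 /m3 aE /quadrant_sign {aE m1 m3 m1_le m3_le}.
by case: e; case: r r4 => [|[|[|[|//]]]] _ /=; ring.
Qed.

Lemma chi4_sq (R : pzRingType) (n : nat) : chi4 R n * chi4 R n = 1.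
Proof. by rewrite -expr2 sqrr_sign. Qed.

(** * Products of two signs summed over the grid *)

(** [u] and [v] are the numbers of cells in one quadrant of each of the two cosines: with [4 a b c]
    cells, the frequency [a] has [u = b c]. *)
Definition quadrant_sum (R : pzRingType) (u v N : nat) : R :=
  \sum_(0 <= k < N) quadrant_sign R (k %/ u) * quadrant_sign R (k %/ v).
Arguments quadrant_sum R u v N : clear implicits.

Lemma quadrant_sumC (R : comPzRingType) (u v N : nat) :
  quadrant_sum R u v N = quadrant_sum R v u N.
Proof. by apply: eq_bigr => k _; rewrite mulrC. Qed.

(** Write [k = 4 q + r]. By periodicity only [q + b j] modulo [a] matters, and it runs through all
    residues, which reduces the sum to the one with offset [r]. *)
Lemma sum_quadrant_sign_shift (R : comNzRingType) (a b k : nat) :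
  odd a -> coprime a b ->
  \sum_(0 <= j < a) quadrant_sign R ((k + 4 * b * j) %/ a) =
    chi4 R a * quadrant_sign R k.
Proof.
move=> odda cop; have a0 := odd_gt0 odda.
rewrite -(quadrant_sign_mod4 R k) -sum_quadrant_sign ?ltn_mod //.
pose h i := quadrant_sign R ((k %% 4 + 4 * i) %/ a).
rewrite -(sum_nat_mod_affine (k %/ 4) h cop); apply: eq_bigr => j _.
rewrite /h -[RHS](@quadrant_sign_divD R _ a ((k %/ 4 + b * j) %/ a)) //.
congr (quadrant_sign R (_ %/ a)).
have := divn_eq (k %/ 4 + b * j) a; have := divn_eq k 4.
by move: (k %/ 4)%N (k %% 4)%N => q r; move: (_ %/ a)%N (_ %% a)%N; lia.
Qed.

Lemma quadrant_sum_odd (R : comNzRingType) (a b : nat) :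
  odd a -> odd b -> coprime a b ->
  quadrant_sum R a b (4 * a * b) = 4 * (chi4 R a * chi4 R b).
Proof.
move=> odda oddb cop; have b0 := odd_gt0 oddb.
rewrite /quadrant_sum (_ : 4 * a * b = a * (4 * b))%N; last by lia.
rewrite sum_nat_mul exchange_big_nat /=.
rewrite (eq_bigr (fun l => chi4 R a * (quadrant_sign R l * quadrant_sign R (l %/ b))));
  last first.
  move=> l _; rewrite mulrA -(sum_quadrant_sign_shift R l odda cop) mulr_suml.
  apply: eq_bigr => j _; rewrite addnC mulnC quadrant_sign_divD //.
(* Second splitting, [l = 4 j + r]: one sign depends on [r] only, and the sum of the other over [j]
   is [chi4 R b] times that same sign. Each of the four [r] thus gives [chi4 R b]. *)
rewrite -mulr_sumr mulnC sum_nat_mul exchange_big_nat /=.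
rewrite (eq_big_nat _ _ (F2 := fun=> chi4 R b)); last first.
  move=> r /andP[_ r4].
  transitivity (quadrant_sign R r * (chi4 R b * quadrant_sign R r)); last first.
    by rewrite mulrCA quadrant_sign_sq mulr1.
  rewrite -sum_quadrant_sign // mulr_sumr; apply: eq_bigr => j _.
  by rewrite addnC [(j * 4)%N]mulnC quadrant_signD4.
by rewrite sumr_const_nat subn0; ring.
Qed.

(** Translation by half the range, [2 a b] cells, moves [k %/ a] by [2 b], an odd number of
    half-turns, and [k %/ b] by [2 a], a whole number of turns. The two halves of the sum cancel. *)
Lemma quadrant_sum_even (R : comNzRingType) (a b : nat) : (0 < a)%N ->
  ~~ odd a -> odd b -> quadrant_sum R a b (4 * a * b) = 0.
Proof.
move=> a0 evena oddb; have b0 := odd_gt0 oddb.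
rewrite /quadrant_sum (_ : 4 * a * b = 2 * (2 * a * b))%N; last by lia.
rewrite sum_nat_mul big_nat_recl // big_nat1 -big_split big1 //= => l _.
rewrite mul0n add0n mul1n.
rewrite (_ : 2 * a * b + l = (2 * b) * a + l)%N; last by lia.
rewrite divnMDl // (_ : 2 * b * a + l = l + 4 * b * (a./2))%N; last by nia.
rewrite quadrant_sign_divD // (_ : 2 * b + l %/ a = l %/ a + 2 + 4 * b./2)%N; last by lia.
by rewrite quadrant_signD4 quadrant_signD2 mulNr addrN.
Qed.

(** Every cell is cut into [m] equal cells, on which both signs are unchanged. *)
Lemma quadrant_sum_scale (R : pzRingType) (m u v n : nat) : (0 < m)%N ->
  quadrant_sum R (m * u) (m * v) (n * m) = m%:R * quadrant_sum R u v n.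
Proof.
move=> m0; rewrite /quadrant_sum sum_nat_mul mulr_sumr; apply: eq_bigr => j _.
rewrite (eq_big_nat _ _
  (F2 := fun=> quadrant_sign R (j %/ u) * quadrant_sign R (j %/ v))).
  by rewrite sumr_const_nat subn0 mulr_natl.
by move=> l /andP[_ lm]; rewrite !divnMA divnMDl // (divn_small lm) addn0.
Qed.

Lemma quadrant_sum_periods (R : pzRingType) (u v n : nat) : (0 < u)%N -> (0 < v)%N ->
  quadrant_sum R u v (n * (4 * u * v)) = n%:R * quadrant_sum R u v (4 * u * v).
Proof.
move=> u0 v0; rewrite /quadrant_sum sum_nat_mul mulr_natl -[in RHS](subn0 n).
rewrite -sumr_const_nat; apply: eq_bigr => j _; apply: eq_bigr => l _.
rewrite addnC (_ : j * (4 * u * v) = 4 * u * (j * v))%N; last by lia.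
rewrite quadrant_sign_divD // (_ : 4 * u * (j * v) = 4 * v * (j * u))%N; last by lia.
by rewrite quadrant_sign_divD.
Qed.

(* The mean of sgn (cos (a x)) * sgn (cos (b x)) over a period. *)
Definition sign_corr (R : unitRingType) (a b : nat) : R :=
  let a' := (a %/ gcdn a b)%N in let b' := (b %/ gcdn a b)%N in
  if odd a' && odd b' then chi4 R a' * chi4 R b' / (a' * b')%:R else 0.
Arguments sign_corr R a b : clear implicits.

(** With [a = g x] and [b = g y], the grid is that of the coprime pair [x], [y], repeated [g] times
    and with each cell cut into [g c] cells. *)
Lemma quadrant_sumE (R : numFieldType) (a b c : nat) :
  (0 < a)%N -> (0 < b)%N -> (0 < c)%N ->
  quadrant_sum R (b * c) (a * c) (4 * a * b * c) = (4 * a * b * c)%:R * sign_corr R a b.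
Proof.
move=> a0 b0 c0; rewrite /sign_corr.
have g0 : (0 < gcdn a b)%N by rewrite gcdn_gt0 a0.
have aE := divnK (dvdn_gcdl a b); have bE := divnK (dvdn_gcdr a b).
have cop : coprime (a %/ gcdn a b) (b %/ gcdn a b).
  by rewrite /coprime -(eqn_pmul2r g0) muln_gcdl aE bE mul1n.
move: (gcdn a b) (a %/ _)%N (b %/ _)%N g0 cop aE bE => g x y g0 cop aE bE.
have x0 : (0 < x)%N by move: a0; rewrite -aE muln_gt0 => /andP[].
have y0 : (0 < y)%N by move: b0; rewrite -bE muln_gt0 => /andP[].
rewrite -aE -bE.
rewrite (_ : y * g * c = g * c * y)%N; last by lia.
rewrite (_ : x * g * c = g * c * x)%N; last by lia.
rewrite (_ : 4 * (x * g) * (y * g) * c = (g * (4 * y * x)) * (g * c))%N; last by nia.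
rewrite quadrant_sum_scale ?muln_gt0 ?g0 // quadrant_sum_periods //.
case: ifPn => [/andP[oddx oddy]|even_xy].
  rewrite quadrant_sum_odd // 1?coprime_sym // !natrM; field.
  by rewrite !pnatr_eq0 -!lt0n x0 y0.
rewrite mulr0 [quadrant_sum _ _ _ _](_ : _ = 0) ?mulr0 //.
have [oddx|evenx] := boolP (odd x).
  by rewrite quadrant_sum_even //; move: even_xy; rewrite oddx.
rewrite quadrant_sumC (_ : 4 * y * x = 4 * x * y)%N; last by lia.
rewrite quadrant_sum_even //; apply: contraT => eveny.
have : (2 %| gcdn x y)%N by rewrite dvdn_gcd !dvdn2 evenx eveny.
by rewrite (eqP cop).
Qed.

(** * Lower bounds for the correlations and their sum *)

Lemma chi4M (R : pzRingType) (x y : nat) : odd x -> odd y ->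
  chi4 R (x * y) = chi4 R x * chi4 R y.
Proof.
move=> oddx oddy; rewrite /chi4 -exprD -signr_odd -[RHS]signr_odd.
congr (_ ^+ nat_of_bool _); rewrite -[x in (x * y)%N]odd_double_half.
rewrite -[y in (_ * y)%N]odd_double_half oddx oddy.
by rewrite (_ : _ * _ = 1 + (2 * x./2 * y./2 + (x./2 + y./2)).*2)%N; lia.
Qed.

Lemma chi4_mul_odd (R : pzRingType) (x y : nat) : odd x -> odd y ->
  chi4 R x * chi4 R y = if (x %% 4 == y %% 4)%N then 1 else -1.
Proof.
move=> oddx oddy; rewrite /chi4 -signr_odd -[(-1) ^+ y./2]signr_odd -signr_addb.
have -> : odd x./2 (+) odd y./2 = (x %% 4 != y %% 4)%N by lia.
by case: eqP.
Qed.

Lemma sign_corr_lt0 (R : numFieldType) (a b : nat) : sign_corr R a b < 0 ->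
  exists x y, [/\ odd x, odd y, (x %% 4 != y %% 4)%N, (a * y = b * x)%N &
    sign_corr R a b = - (x * y)%:R^-1].
Proof.
rewrite /sign_corr => corr_lt0.
exists (a %/ gcdn a b)%N, (b %/ gcdn a b)%N.
have cross : (a * (b %/ gcdn a b) = b * (a %/ gcdn a b))%N.
  by rewrite !muln_divA ?dvdn_gcdl ?dvdn_gcdr // mulnC.
move: corr_lt0; case: ifP => [/andP[oddx oddy]|_]; last by rewrite ltxx.
rewrite chi4_mul_odd //; case: eqP => [_|/eqP xy]; last by split => //; rewrite mulN1r.
by rewrite mul1r invr_lt0 ltrn0.
Qed.

(** A negative value is [-1/(x y)] with [x < y] odd and incongruent modulo 4, so [x y] is 3 modulo
    4: it is 3, which forces the ratio 3, or at least 7. *)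
Lemma sign_corr_lb (R : realFieldType) (a b : nat) : (0 < a < b)%N ->
  b = (3 * a)%N \/ - 7^-1 <= sign_corr R a b.
Proof.
move=> /andP[a0 ltab].
have [|/sign_corr_lt0[x [y [oddx oddy xy4 cross ->]]]] := leP 0 (sign_corr R a b).
  by move=> corr0; right; apply: le_trans corr0; lra.
have ltxy : (x < y)%N by rewrite -(ltn_pmul2l a0) cross ltn_pmul2r ?odd_gt0.
have [[x1 y3]|xy7] : (x = 1 /\ y = 3)%N \/ (7 <= x * y)%N.
  by case: x xy4 {cross} oddx ltxy => [|[|[|x]]] //; nia.
- by left; move: cross; rewrite x1 y3; lia.
- by right; rewrite lerN2 lef_pV2 ?posrE ?ltr0n ?ler_nat //; lia.
Qed.

(* The ratios [y/x], [y''/x''] multiply to [y'/x'], and the character of each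
   would be [-1]. *)
Lemma sign_corr_not_all_lt0 (R : numFieldType) (a b c : nat) : (0 < a)%N ->
  sign_corr R a b < 0 -> sign_corr R a c < 0 -> sign_corr R b c < 0 -> False.
Proof.
move=> a0 /sign_corr_lt0[x [y [oddx oddy xy cross_ab _]]].
move=> /sign_corr_lt0[x' [y' [oddx' oddy' xy' cross_ac _]]].
move=> /sign_corr_lt0[x'' [y'' [oddx'' oddy'' xy'' cross_bc _]]].
have : (y * y'' * x' = x * x'' * y')%N.
  apply/eqP; rewrite -(eqn_pmul2l a0); apply/eqP.
  transitivity (b * y'' * x * x')%N; first by rewrite !mulnA cross_ab; lia.
  rewrite cross_bc (_ : a * (x * x'' * y') = x * x'' * (a * y'))%N; last by lia.
  by rewrite cross_ac; lia.
move=> /(congr1 (chi4 R)); rewrite !chi4M ?oddM ?oddx ?oddx' ?oddx'' ?oddy ?oddy'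
  ?oddy'' //.
have chiN (m n : nat) : odd m -> odd n -> (m %% 4 != n %% 4)%N -> chi4 R n = - chi4 R m.
  move=> oddm oddn mn; have := chi4_mul_odd R oddm oddn; rewrite (negPf mn).
  by move=> /(congr1 ( *%R (chi4 R m))); rewrite mulrA chi4_sq mul1r mulrN1.
(* Two sign changes cancel on the left and one survives on the right, so a product of signs would
   equal its opposite. *)
rewrite (chiN _ _ oddx oddy xy) (chiN _ _ oddx' oddy' xy') (chiN _ _ oddx'' oddy'' xy'').
rewrite mulrNN mulrN => /eqP; rewrite eq_sym eqNr.
by rewrite !mulf_eq0 !signr_eq0.
Qed.

Lemma sign_corr_multiple (R : unitRingType) (a k : nat) : (0 < a)%N -> odd k ->
  sign_corr R a (k * a) = chi4 R k / k%:R.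
Proof.
move=> a0 oddk; rewrite /sign_corr (gcdn_idPl _) ?dvdn_mull // divnn a0 mulnK //.
by rewrite oddk mul1n mul1r.
Qed.

Lemma sign_corr_sum_lb (R : realFieldType) (a b c : nat) :
  (0 < a)%N -> (a < b)%N -> (b < c)%N ->
  let S := sign_corr R a b + sign_corr R a c + sign_corr R b c in
  - (5 / 9) <= S /\ (S = - (5 / 9) <-> b = (3 * a)%N /\ c = (9 * a)%N).
Proof.
move=> a0 ltab ltbc S.
have b0 := ltn_trans a0 ltab; have ltac := ltn_trans ltab ltbc.
have [[b3 c9]|not139] : (b = 3 * a /\ c = 9 * a)%N \/ ~ (b = 3 * a /\ c = 9 * a)%N by lia.
  have -> : S = - (5 / 9).
    rewrite /S (_ : sign_corr R b c = sign_corr R b (3 * b)); last first.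
      by congr sign_corr; lia.
    by rewrite b3 c9 !sign_corr_multiple ?muln_gt0 // /chi4 /=; field.
  by split; [exact: lexx|split].
suff ltS : - (5 / 9) < S.
  by split; [exact: ltW|split=> [SE|//]; move: ltS; rewrite SE ltxx].
have ge3 (m n : nat) : (0 < m < n)%N -> - 3^-1 <= sign_corr R m n.
  move=> mn; have [->|ge7] := sign_corr_lb R mn; last by lra.
  by rewrite sign_corr_multiple ?(andP mn).1 // /chi4 /=; lra.
have abP : (0 < a < b)%N by rewrite a0.
have acP : (0 < a < c)%N by rewrite a0.
have bcP : (0 < b < c)%N by rewrite b0.
have nneg := @sign_corr_not_all_lt0 R a b c a0.
(* At most one pair has ratio 3: two pairs sharing their smaller or their larger member would
   violate the strict order, and [b = 3 a], [c = 3 b] is the excluded case. *)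
have [[ab7 ac7]|[[ab7 bc7]|[ac7 bc7]]] :
    (- 7^-1 <= sign_corr R a b /\ - 7^-1 <= sign_corr R a c) \/
    (- 7^-1 <= sign_corr R a b /\ - 7^-1 <= sign_corr R b c) \/
    (- 7^-1 <= sign_corr R a c /\ - 7^-1 <= sign_corr R b c).
  have := sign_corr_lb R abP; have := sign_corr_lb R acP; have := sign_corr_lb R bcP.
  by move=> [?|?] [?|?] [?|?]; tauto || lia.
all: have := ge3 _ _ abP; have := ge3 _ _ acP; have := ge3 _ _ bcP; rewrite /S.
(* As soon as one correlation is nonnegative, the other two add up to at least [-1/3 - 1/7]. *)
all: have [|] := leP 0 (sign_corr R a b); have [|] := leP 0 (sign_corr R a c);
  have [|] := leP 0 (sign_corr R b c); try lra.
all: by move=> bc ac ab; case: (nneg ab ac bc).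
Qed.

(** * From signs on open cells to Lebesgue measure *)

(** Two quadrants make a half-turn, which negates both factors; the induction descends by two to the
    quadrants 0 and 1. *)
Lemma quadrant_sign_cos (R : realType) (p : nat) (y : R) :
  p%:R * (pi / 2) < y < p.+1%:R * (pi / 2) -> 0 < quadrant_sign R p * cos y.
Proof.
have [n np] := ubnP p; elim: n => // n IHn in p y np *.
case: p np => [|[|p]] np /andP[ylo yhi].
- rewrite /quadrant_sign mul1r cos_gt0_pihalf //; apply/andP; split; lra.
- have ypi : cos (y - pi) = - cos y.
    by rewrite -[in RHS](subrK pi y) cosDpi opprK.
  rewrite /quadrant_sign expr1 mulN1r -ypi cos_gt0_pihalf //; apply/andP; split; lra.
- have ypi : cos (y - pi) = - cos y.
    by rewrite -[in RHS](subrK pi y) cosDpi opprK.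
  rewrite -addn2 quadrant_signD2 mulNr -mulrN -ypi; apply: IHn; first by lia.
  by move: ylo yhi; rewrite -[p.+3]addn2 -[p.+2]addn2 !natrD => ylo yhi; apply/andP;
    split; lra.
Qed.

(** A quadrant of [a x] is made of exactly [u] cells, so cell [k] lies within quadrant [k %/ u]. *)
Lemma quadrant_sign_cell (R : realType) (a u k : nat) (x : R) :
  (0 < a)%N -> (0 < u)%N ->
  let d := 2 * pi / (4 * a * u)%:R in
  k%:R * d < x < k.+1%:R * d -> 0 < quadrant_sign R (k %/ u) * cos (a%:R * x).
Proof.
move=> a0 u0 d /andP[xlo xhi]; apply: quadrant_sign_cos.
have aR : 0 < a%:R :> R by rewrite ltr0n.
have uR : 0 < u%:R :> R by rewrite ltr0n.
have pi0 := pi_gt0 R.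
have dE : pi / 2 = a%:R * (u%:R * d) by rewrite /d !natrM; field; rewrite !gt_eqF.
have d0 : 0 < d by rewrite divr_gt0 ?mulr_gt0 ?ltr0n ?muln_gt0 ?a0.
clearbody d; rewrite dE !(mulrCA _ a%:R) !ltr_pM2l // !mulrA -!natrM; apply/andP; split.
- by apply: le_lt_trans xlo; rewrite ler_pM2r // ler_nat leq_trunc_div.
- by apply: lt_le_trans xhi _; rewrite ler_pM2r // ler_nat ltn_ceil.
Qed.

Lemma cos_same_sign3E (R : realType) (a b c : nat) :
  cos_same_sign R [tuple a; b; c] =
  `[0, 2 * pi] `&`
   ([set x | 0 < cos (a%:R * x)] `&` [set x | 0 < cos (b%:R * x)] `&`
    [set x | 0 < cos (c%:R * x)] `|`
    [set x | cos (a%:R * x) < 0] `&` [set x | cos (b%:R * x) < 0] `&`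
    [set x | cos (c%:R * x) < 0]).
Proof.
apply/seteqP; split=> x /=.
  move=> [x2pi [/bigmin_gtP[_ H]|/bigmax_ltP[_ H]]]; split=> //; [left|right].
    by split; [split|]; [exact: (H 0)|exact: (H 1)|exact: (H ord_max)].
  by split; [split|]; [exact: (H 0)|exact: (H 1)|exact: (H ord_max)].
move=> [x2pi [[[Ha Hb] Hc]|[[Ha Hb] Hc]]]; split=> //; [left|right].
  (* The condition on the default value of the bigop is the one on the term of index 0. *)
  apply/bigmin_gtP; split=> // i _.
  by case: i => [[|[|[|//]]] ?].
apply/bigmax_ltP; split=> // i _.
by case: i => [[|[|[|//]]] ?].
Qed.

Lemma measurable_cos_same_sign3 (R : realType) (a b c : nat) :
  measurable (cos_same_sign R [tuple a; b; c]).
Proof.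
have cont (n : nat) : continuous (fun x : R => cos (n%:R * x)).
  move=> x; apply: (continuous_comp (f := fun x : R => n%:R * x) (g := @cos R)).
    exact: mulrl_continuous.
  exact: continuous_cos.
have pos (n : nat) : measurable [set x : R | 0 < cos (n%:R * x)].
  apply: open_measurable.
  apply: (open_comp (f := fun x : R => cos (n%:R * x)) (D := [set y | 0 < y])).
    by move=> x _; exact: cont.
  exact: open_gt.
have neg (n : nat) : measurable [set x : R | cos (n%:R * x) < 0].
  apply: open_measurable.
  apply: (open_comp (f := fun x : R => cos (n%:R * x)) (D := [set y | y < 0])).
    by move=> x _; exact: cont.
  exact: open_lt.
rewrite cos_same_sign3E; apply: measurableI; first exact: measurable_itv.
by apply: measurableU; do 2![apply: measurableI => //].
Qed.

(** Nothing is assumed at the grid points. Each induction step adds a half-open cell, whose right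
    endpoint is a null set. *)
Lemma lebesgue_measure_cells (R : realType) (S : set R) (d : R) (P : pred nat) (n : nat) :
  measurable S -> 0 < d ->
  (forall k x, k%:R * d < x < k.+1%:R * d -> (k < n)%N -> S x <-> P k) ->
  lebesgue_measure (S `&` `[0, n%:R * d]) = (d * \sum_(0 <= k < n) (P k)%:R)%:E.
Proof.
move=> mS d0; elim: n => [|n IHn] cellP.
  rewrite mul0r set_itv1 big_nil mulr0.
  apply: (@subset_measure0 _ _ _ lebesgue_measure _ [set (0:R)]).
  - exact: measurableI.
  - exact: measurable_set1.
  - exact: subIsetr.
  - exact: lebesgue_measure_set1.
have le_nd : n%:R * d <= n.+1%:R * d by rewrite ler_pM2r // ler_nat.
have -> : `[0, n.+1%:R * d]%classic =
    `[0, n%:R * d]%classic `|` `]n%:R * d, n.+1%:R * d]%classic :> set R.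
  by rewrite -itv_bndbnd_setU // bnd_simp ?mulr_ge0 // ltW.
have mI (u v : R) : measurable (S `&` `]u, v]) by apply: measurableI.
rewrite setIUr measureU; [|by apply: measurableI|exact: mI|]; last first.
  apply/seteqP; split=> // x /= [[_ ]];
    rewrite !in_itv /= => /andP[_ xlo] [_ /andP[xhi _]].
  by move: (le_lt_trans xlo xhi); rewrite ltxx.
rewrite big_nat_recr //= mulrDr EFinD; congr (_ + _)%E.
  by apply: IHn => k x xk kn; apply: cellP => //; exact: ltnW.
have len : (n.+1%:R * d - n%:R * d) = d by rewrite -natr1; ring.
have lt_nd : ((n%:R * d)%:E < (n.+1%:R * d)%:E)%E by rewrite lte_fin ltr_pM2r // ltr_nat.
have mu_oc : lebesgue_measure `]n%:R * d, n.+1%:R * d]%classic = d%:E.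
  by rewrite lebesgue_measure_itv /= lt_nd -EFinB len.
have mu_oo : lebesgue_measure `]n%:R * d, n.+1%:R * d[%classic = d%:E.
  by rewrite lebesgue_measure_itv /= lt_nd -EFinB len.
case: (boolP (P n)) => Pn.
(* The added piece lies between the open and the half-open cell, both of measure [d]. *)
- apply/eqP; rewrite mulr1 eq_le; apply/andP; split.
    rewrite -mu_oc; apply: le_measure; rewrite ?inE //; exact: mI.
  rewrite -mu_oo; apply: le_measure; rewrite ?inE //; first exact: mI.
  move=> x /= xn; split; first exact/(cellP n).
  by move: xn; rewrite !in_itv /= => /andP[-> /ltW].
(* Only the right endpoint of the cell can belong to [S]. *)
- rewrite mulr0; apply: (@subset_measure0 _ _ _ lebesgue_measure _ [set n.+1%:R * d])
    => //.
  + exact: mI.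
  + move=> x [Sx]; rewrite /= in_itv /= le_eqVlt => /andP[xlo /orP[/eqP //|xhi]].
    have xn : n%:R * d < x < n.+1%:R * d by rewrite xlo.
    by move: ((cellP n x xn (ltnSn n)).1 Sx); rewrite (negPf Pn).
  + exact: lebesgue_measure_set1.
Qed.

(** * The probability in terms of the correlations *)

Lemma same_sign3P (R : realDomainType) (i j k : nat) (x y z : R) :
  0 < quadrant_sign R i * x -> 0 < quadrant_sign R j * y -> 0 < quadrant_sign R k * z ->
  ([/\ 0 < x, 0 < y & 0 < z] \/ [/\ x < 0, y < 0 & z < 0]) <->
  (quadrant_sign R i == quadrant_sign R j) && (quadrant_sign R i == quadrant_sign R k).
Proof.
rewrite /quadrant_sign -signr_odd -[(-1) ^+ uphalf j]signr_odd.
rewrite -[(-1) ^+ uphalf k]signr_odd !(inj_eq (@signr_inj R)).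
do 3![case: (odd _)]; rewrite /= ?expr0 ?expr1 ?mul1r ?mulN1r ?oppr_gt0 => sx sy sz;
  split=> //; try by case=> -[]; lra.
all: by move=> _; (left + right).
Qed.

Lemma prob_same_sign3E (R : realType) (a b c : nat) :
  (0 < a)%N -> (0 < b)%N -> (0 < c)%N ->
  prob_same_sign R [tuple a; b; c] =
  (1 + sign_corr R a b + sign_corr R a c + sign_corr R b c) / 4.
Proof.
move=> a0 b0 c0.
pose N := (4 * a * b * c)%N; pose d : R := 2 * pi / N%:R.
have pi0 := pi_gt0 R.
have N0 : 0 < N%:R :> R by rewrite ltr0n !muln_gt0 a0 b0.
have d0 : 0 < d by rewrite divr_gt0 ?mulr_gt0.
have Nd : N%:R * d = 2 * pi by rewrite /d; field; rewrite gt_eqF.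
pose qa k := quadrant_sign R (k %/ (b * c)).
pose qb k := quadrant_sign R (k %/ (a * c)).
pose qc k := quadrant_sign R (k %/ (a * b)).
pose agree k := (qa k == qb k) && (qa k == qc k).
(* If the three signs do not all agree, exactly one pair agrees, and the products sum to -1. *)
have agreeE k : (agree k)%:R = 4^-1 * (1 + qa k * qb k + qa k * qc k + qb k * qc k).
  rewrite /agree /qa /qb /qc /quadrant_sign.
  rewrite -signr_odd -[(-1) ^+ uphalf (k %/ (a * c))]signr_odd.
  rewrite -[(-1) ^+ uphalf (k %/ (a * b))]signr_odd !(inj_eq (@signr_inj R)).
  by case: (odd _); case: (odd _); case: (odd _) => /=; field.
have cellP k x : k%:R * d < x < k.+1%:R * d -> (k < N)%N ->
    cos_same_sign R [tuple a; b; c] x <-> agree k.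
  move=> xk kN.
  have sa : 0 < qa k * cos (a%:R * x).
    apply: quadrant_sign_cell => //; first by rewrite muln_gt0 b0.
    by rewrite (_ : 4 * a * (b * c) = N)%N // /N; lia.
  have sb : 0 < qb k * cos (b%:R * x).
    apply: quadrant_sign_cell => //; first by rewrite muln_gt0 a0.
    by rewrite (_ : 4 * b * (a * c) = N)%N // /N; lia.
  have sc : 0 < qc k * cos (c%:R * x).
    apply: quadrant_sign_cell => //; first by rewrite muln_gt0 a0.
    by rewrite (_ : 4 * c * (a * b) = N)%N // /N; lia.
  have x2pi : `[0, 2 * pi]%classic x.
    case/andP: xk => xlo xhi; rewrite /= in_itv; apply/andP; split.
      by apply: ltW; apply: le_lt_trans xlo; rewrite mulr_ge0 // ltW.
    by rewrite -Nd; apply: ltW; apply: lt_le_trans xhi _; rewrite ler_pM2r // ler_nat.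
  rewrite cos_same_sign3E /agree -(same_sign3P sa sb sc).
  by split=> [[_ [[[? ?] ?]|[[? ?] ?]]]|[[? ? ?]|[? ? ?]]] //;
    [left|right|split=> //; left|split=> //; right].
rewrite /prob_same_sign.
have -> : cos_same_sign R [tuple a; b; c] =
    cos_same_sign R [tuple a; b; c] `&` `[0, N%:R * d].
  by apply/esym/setIidPl; rewrite Nd => x [].
rewrite (lebesgue_measure_cells _ d0 cellP); last first.
  exact: measurable_cos_same_sign3.
rewrite (eq_bigr _ (fun k _ => agreeE k)) -mulr_sumr !big_split /=.
rewrite sumr_const_nat subn0 -/(quadrant_sum R _ _ _).
have := quadrant_sumE R a0 b0 c0; rewrite /quadrant_sum => ->.
have := quadrant_sumE R a0 c0 b0.
rewrite (mulnC c b) (_ : 4 * a * c * b = N)%N /quadrant_sum; last by rewrite /N; lia.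
move=> ->.
have := quadrant_sumE R b0 c0 a0.
rewrite (mulnC c a) (mulnC b a) (_ : 4 * b * c * a = N)%N /quadrant_sum;
  last by rewrite /N; lia.
move=> ->.
rewrite -/N /d; move: N%:R N0 (@pi R) pi0 => M M0 p p0.
by field; rewrite !gt_eqF.
Qed.

Theorem mainTheorem1 (R : realType) (a1 a2 a3 : nat)
    (ha1 : (0 < a1)%N) (h12 : (a1 < a2)%N) (h23 : (a2 < a3)%N) :
  let P := prob_same_sign R [tuple a1; a2; a3] in
  let g := gcdn a1 (gcdn a2 a3) in
  9^-1 <= P /\
  (P = 9^-1 <-> [set a1; a2; a3] = [set g; (3 * g)%N; (9 * g)%N]).
Proof.
move=> P g.
have ha2 := ltn_trans ha1 h12; have ha3 := ltn_trans ha2 h23.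
have [ge_S S_eq] := sign_corr_sum_lb R ha1 h12 h23.
have -> : P = (1 + sign_corr R a1 a2 + sign_corr R a1 a3 + sign_corr R a2 a3) / 4.
  exact: prob_same_sign3E.
(* The bound [-5/9] on the sum becomes [(1 - 5/9) / 4 = 1/9]. *)
split; first by lra.
have -> : [set a1; a2; a3] = [set g; (3 * g)%N; (9 * g)%N] <->
    a2 = (3 * a1)%N /\ a3 = (9 * a1)%N.
  split=> [/seteqP[sub sub']|[e2 e3]].
    have a1in := sub a1 (or_introl (or_introl erefl)).
    have a2in := sub a2 (or_introl (or_intror erefl)).
    have a3in := sub a3 (or_intror erefl).
    (* Three strictly increasing members of [g], [3 g], [9 g] must be these numbers in this
       order. *)
    by move: a1in a2in a3in => /=; lia.
  have -> : g = a1 by rewrite /g (gcdn_idPl _) // dvdn_gcd e2 e3 !dvdn_mull.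
  by rewrite e2 e3.
by rewrite -S_eq; split; lra.
Qed.
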